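(* For natural numbers $m,n$ with $m<n$, $\widehat{\otimes}_\varepsilon^n\ell_1$ is not isomorphic to any subspace of $\widehat{\otimes}_\varepsilon^m\ell_1$.
   Context: Scalars are $\mathbb{R}$ or $\mathbb{C}$; ''subspace'' means closed subspace; ''isomorphic'' means linearly homeomorphic. $\widehat{\otimes}_\varepsilon^n\ell_1$ denotes the $n$-fold completed injective tensor product of $\ell_1$ with itself ($\widehat{\otimes}_\varepsilon^1\ell_1=\ell_1$). *)

(* Defs.v *)
From HB Require Import structures.
From mathcomp Require Import all_boot all_order all_algebra.
From mathcomp Require Import complex.
From mathcomp Require Import boolp classical_sets functions reals.
From mathcomp Require Import topology normedtype.

Set Implicit Arguments.
Unset Strict Implicit.
Unset Printing Implicit Defensive.

Import Order.TTheory GRing.Theory Num.Theory.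
Import numFieldNormedType.Exports.

Local Open Scope classical_set_scope.
Local Open Scope ring_scope.

Definition nneg_complete (K : numFieldType) := forall A : set K,
  A !=set0 -> (forall x, A x -> 0 <= x) -> (exists M, ubound A M) ->
  exists s, supremums A s.

Definition cauchy_complete (K : numFieldType) := forall F : set_system K,
  ProperFilter F -> cauchy F -> cvg F.

(* The two scalar fields are [R] and [R[i]] for [R : realType]; the interface
   below only collects what is used to build the spaces over both at once. The
   norm of a [normedModType K] takes its values in [K], so that the norms below
   are nonnegative elements of [K]; on [R[i]] the order is the partial order
   whose nonnegative elements are the nonnegative reals. *)
HB.mixin Record isScalarField K & Num.NumField K := {
  nneg_completeP : nneg_complete K ;
  cauchy_completeP : cauchy_complete K
}.

#[short(type="scalarFieldType")]
HB.structure Definition ScalarField := {K of Num.NumField K & isScalarField K}.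

Section real_scalars.
Variable R : realType.

Lemma real_nneg_complete : nneg_complete R.
Proof.
move=> A A0 _ Aub; exists (sup A); split; first exact: sup_upper_bound.
by move=> M AM; exact: ge_sup.
Qed.

HB.instance Definition _ :=
  isScalarField.Build R real_nneg_complete (@R_complete R).

End real_scalars.

Section complex_scalars.
Variable R : realType.
Local Notation C := R[i].
Local Open Scope complex_scope.

Lemma complex_nneg_complete : nneg_complete C.
Proof.
move=> A [x0 Ax0] A0 [M AM].
have AE x : A x -> x = (complex.Re x)%:C.
  move=> /A0; case: x => a b /=; rewrite lecE /= => /andP[/eqP -> _] //.
pose B := [set complex.Re x | x in A].
have hB : has_sup B.
  split; first by exists (complex.Re x0), x0.
  exists (complex.Re M) => _ [x Ax <-].
  by have := AM _ Ax; rewrite lecE => /andP[].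
exists (sup B)%:C; split.
  move=> x Ax; rewrite (AE _ Ax) lecR; apply: sup_upper_bound => //.
  by exists x.
move=> N AN; have := AN _ Ax0; rewrite {1}(AE _ Ax0) !lecE /= => /andP[-> _] /=.
apply: ge_sup; first by case: hB.
by move=> _ [x Ax <-]; have := AN _ Ax; rewrite lecE => /andP[].
Qed.

Lemma normc_ge_Im (x : C) : `|complex.Im x|%:C <= `|x|.
Proof.
case: x => a b; rewrite normc_def lecR /=.
by rewrite -sqrtr_sqr ler_wsqrtr // lerDr sqr_ge0.
Qed.

Lemma complex_cauchy_complete : cauchy_complete C.
Proof.
move=> F FF /cauchyP Fc.
have cpt (p : C -> R) : (forall x y, p (x - y) = p x - p y) ->
   (forall x, `|p x|%:C <= `|x|) -> cvg (p @ F).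
  move=> pB ple; apply: R_complete; apply/cauchyP => e e0.
  have [|x Fx] := Fc e%:C; first by rewrite ltcR.
  exists (p x).
  have sub : ball x e%:C `<=` p @^-1` ball (p x) e.
    move=> y; rewrite -ball_normE /= => xy.
    by rewrite -ball_normE /= -ltcR -pB (le_lt_trans (ple _)).
  exact: (filterS sub Fx).
have /cvg_ex[a Fa] : cvg (@complex.Re R @ F).
  by apply: cpt => [[? ?] [? ?]|x] //; exact: normc_ge_Re.
have /cvg_ex[b Fb] : cvg (@complex.Im R @ F).
  by apply: cpt => [[? ?] [? ?]|x] //; exact: normc_ge_Im.
apply/cvg_ex; exists (a +i* b); apply/cvgrPdist_lt => /= e e0.
have [r0 eE] : 0 < complex.Re e / 2 /\ e = (complex.Re e)%:C.
  case: e e0 => c d; rewrite ltcE /= => /andP[/eqP -> c0]; split => //.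
  by rewrite divr_gt0.
have dec z : a +i* b - z = (a - complex.Re z)%:C + 'i * (b - complex.Im z)%:C.
  by case: z => c d; simpc.
near=> z; rewrite dec eE (splitr (complex.Re e)) [ltRHS]rmorphD.
apply: (le_lt_trans (ler_normD _ _)); apply: ltrD.
  rewrite normc_def /= expr0n addr0 sqrtr_sqr ltcR.
  by near: z; move/cvgrPdist_lt: Fa; apply.
rewrite normrM normc_def /= normc_def /= !expr0n /= addr0 add0r expr1n sqrtr1.
rewrite sqrtr_sqr mul1r ltcR.
by near: z; move/cvgrPdist_lt: Fb; apply.
Unshelve. all: by end_near. Qed.

HB.instance Definition _ :=
  isScalarField.Build C complex_nneg_complete complex_cauchy_complete.
End complex_scalars.

Definition range_sup (K : numFieldType) (I : Type) (f : I -> K) : K :=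
  supremum 0 (range f).

Section range_sup_theory.
Variables (K : scalarFieldType) (I : Type) (i0 : I) (f : I -> K).
Hypotheses (f_ge0 : forall i, 0 <= f i).
Hypotheses (f_ub : exists M, forall i, f i <= M).

Lemma range_supP : supremums (range f) (range_sup f).
Proof.
have [s fs] : exists s, supremums (range f) s.
  apply: nneg_completeP; first by exists (f i0), i0.
    by move=> _ [i _ <-].
  by case: f_ub => M fM; exists M => _ [i _ <-].
rewrite /range_sup /supremum; case: ifPn => [/eqP f0|_]; last by apply: xgetPex; exists s.
by have : set0 (f i0) by rewrite -f0; exists i0.
Qed.

Lemma range_sup_ub i : f i <= range_sup f.
Proof. by apply: range_supP.1; exists i. Qed.

Lemma range_sup_le M : (forall i, f i <= M) -> range_sup f <= M.
Proof. by move=> fM; apply: range_supP.2 => _ [i _ <-]. Qed.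

End range_sup_theory.

Lemma range_supZ (K : scalarFieldType) (I : Type) (i0 : I) (f : I -> K) (c : K) :
  (forall i, 0 <= f i) -> (exists M, forall i, f i <= M) -> 0 <= c ->
  range_sup (fun i => c * f i) = c * range_sup f.
Proof.
move=> f0 fM c0.
have cf0 i : 0 <= c * f i by rewrite mulr_ge0.
have cfM : exists M, forall i, c * f i <= M.
  by case: fM => M fM; exists (c * M) => i; rewrite ler_wpM2l.
apply: le_anti; apply/andP; split.
  apply: range_sup_le => // i; rewrite ler_wpM2l//; exact: range_sup_ub.
have [c_0|cn0] := eqVneq c 0.
  rewrite {1}c_0 mul0r; exact: le_trans (cf0 i0) (range_sup_ub i0 cf0 cfM i0).
have cgt0 : 0 < c by rewrite lt_def cn0.
rewrite -ler_pdivlMl//; apply: range_sup_le => // i.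
by rewrite ler_pdivlMl//; exact: (range_sup_ub i0 cf0 cfM).
Qed.

Lemma range_sup_norm_complete (K : numFieldType) (E : normedModType K)
    (T J : Type) (v : E -> T -> K) (q : J -> (T -> K) -> K) :
  cauchy_complete K ->
  (forall x y t, v (x - y) t = v x t - v y t) ->
  (forall t, exists j, forall f, `|f t| <= q j f) ->
  (forall x j, q j (v x) <= `|x|) ->
  (forall x M, (forall j, q j (v x) <= M) -> `|x| <= M) ->
  (forall j f g, q j (f \+ g) <= q j f + q j g) ->
  (forall j, exists s : seq T, forall f, q j f <= \sum_(t <- s) `|f t|) ->
  (forall f, (forall e, 0 < e -> exists x, forall j, q j (v x \- f) <= e) ->
     exists x, v x = f) ->
  forall F : set_system E, ProperFilter F -> cauchy F -> cvg F.
Proof.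
move=> Kcomplete vB qpt qle leq qD qfin vcl F FF Fc.
have vpt x t : `|v x t| <= `|x|.
  by have [j qj] := qpt t; apply: le_trans (qj _) (qle _ _).
have Fb e : 0 < e -> exists2 x, F (ball x e) & True.
  by move=> e0; have /cauchyP/(_ e e0)[x Fx] := Fc; exists x.
have Fpt t : exists l : K, (v ^~ t) @ F --> l.
  apply/cvg_ex; apply: Kcomplete; apply/cauchyP => e e0.
  have [x Fx _] := Fb _ e0; exists (v x t).
  have sub : ball x e `<=` (v ^~ t) @^-1` ball (v x t) e.
    move=> y; rewrite -ball_normE /= => xy.
    by rewrite -ball_normE /= -vB (le_lt_trans (vpt _ _)).
  exact: (filterS sub Fx).
have [f Ff] := boolp.choice Fpt.
have key x e : 0 < e -> F (ball x e) -> forall j, q j (v x \- f) <= e.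
  move=> e0 Fx j; have [s qs] := qfin j.
  have eK : e \is Num.real by rewrite gtr0_real.
  apply/ler_addgt0Pr => d d0.
  pose d' := d / (size s).+1%:R.
  have d'0 : 0 < d' by rewrite divr_gt0.
  have Fs : F [set y | \sum_(t <- s) `|v y t - f t| <= (size s)%:R * d'].
    elim: s {qs} d' d'0 => [|t s IH] d' d'0.
      by apply: filterE => y /=; rewrite big_nil mul0r.
    have /cvgrPdist_lt/(_ _ d'0) Ft := Ff t.
    apply: filterS2 Ft (IH _ d'0) => y yt ys /=.
    by rewrite big_cons -natr1 addrC mulrDl mul1r lerD// distrC ltW.
  have [y [xy ys]] := filter_ex (filterI Fx Fs).
  have -> : v x \- f = (v (x - y)) \+ (v y \- f).
    by apply/funext => t /=; rewrite vB addrA subrK.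
  apply: le_trans (qD _ _ _) _; apply: lerD.
    apply: le_trans (qle _ _) _; apply: ltW.
    by move: xy; rewrite -ball_normE.
  apply: le_trans (qs _) _.
  apply: le_trans ys _.
  rewrite /d' mulrCA ler_piMr ?(ltW d0)// ler_pdivrMr// mul1r ler_nat//.
have [x vx] : exists x, v x = f.
  apply: vcl => e e0; have [x Fx _] := Fb _ e0.
  by exists x => j; apply: key.
apply/cvg_ex; exists x; apply/cvgrPdist_le => e e0.
have /cauchy_ballP/(_ _ e0) := Fc.
have e20 : 0 < e / 2 by rewrite divr_gt0.
have [z Fz _] := Fb _ e20; move=> _.
apply: filterS (Fz) => y zy; rewrite (splitr e).
rewrite -(subrKA z); apply: le_trans (ler_normD _ _) _; apply: lerD; last first.
  by move: zy; rewrite -ball_normE/= => /ltW.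
rewrite distrC; apply: leq => j.
have -> : v (z - x) = v z \- f by apply/funext => t; rewrite vB vx.
exact: key.
Qed.

Section ell1.
Variable K : scalarFieldType.

Definition l1_partial (x : nat -> K) (n : nat) : K := \sum_(i < n) `|x i|.

(* [K^o] is [K] seen as a module over itself, and [nat -> K^o] carries the
   pointwise module structure. *)
Definition l1_pred : {pred nat -> K^o} :=
  [pred x | `[< exists M, forall n, l1_partial x n <= M >]].

Lemma l1_partial_ge0 x n : 0 <= l1_partial x n.
Proof. by apply: sumr_ge0. Qed.

Lemma l1_partialD (x y : nat -> K^o) n :
  l1_partial (x + y) n <= l1_partial x n + l1_partial y n.
Proof. by rewrite -big_split; apply: ler_sum => i _; exact: ler_normD. Qed.

Lemma l1_partialZ (a : K) (x : nat -> K^o) n :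
  l1_partial (a *: x) n = `|a| * l1_partial x n.
Proof. by rewrite mulr_sumr; apply: eq_bigr => i _; exact: normrM. Qed.

Lemma l1_submod_closed : submod_closed l1_pred.
Proof.
split=> [|a x y].
  by apply/asboolP; exists 0 => n; rewrite /l1_partial big1// => i; rewrite normr0.
move=> /asboolP[M xM] /asboolP[N yN]; apply/asboolP.
exists (`|a| * M + N) => n; apply: le_trans (l1_partialD _ _ _) _.
by rewrite lerD// l1_partialZ ler_wpM2l.
Qed.

HB.instance Definition _ := GRing.isSubmodClosed.Build _ _ l1_pred
  l1_submod_closed.

Definition ell1 := {x : nat -> K^o | x \in l1_pred}.

HB.instance Definition _ := SubChoice.on ell1.
HB.instance Definition _ := [SubChoice_isSubLmodule of ell1 by <:].

Definition l1_norm (x : ell1) : K := range_sup (l1_partial (val x)).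

Lemma l1_partial_ub (x : ell1) : exists M, forall n, l1_partial (val x) n <= M.
Proof. exact/asboolP/(valP x). Qed.

Lemma l1_partial_le (x : ell1) n : l1_partial (val x) n <= l1_norm x.
Proof. exact: (range_sup_ub 0%N (l1_partial_ge0 _) (l1_partial_ub x)). Qed.

Lemma l1_norm_le (x : ell1) M :
  (forall n, l1_partial (val x) n <= M) -> l1_norm x <= M.
Proof. exact: (range_sup_le 0%N (l1_partial_ge0 _) (l1_partial_ub x)). Qed.

Lemma l1_normD (x y : ell1) : l1_norm (x + y) <= l1_norm x + l1_norm y.
Proof.
apply: l1_norm_le => n; apply: le_trans (l1_partialD _ _ _) _.
by rewrite lerD ?l1_partial_le.
Qed.

Lemma l1_normZ (a : K) (x : ell1) : l1_norm (a *: x) = `|a| * l1_norm x.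
Proof.
rewrite -(range_supZ 0%N (l1_partial_ge0 _) (l1_partial_ub x))//.
by congr range_sup; apply/funext => n; exact: l1_partialZ.
Qed.

Lemma l1_norm0_eq0 (x : ell1) : l1_norm x = 0 -> x = 0.
Proof.
move=> x0; apply: val_inj; apply/funext => i /=.
apply/normr0_eq0/le_anti; rewrite normr_ge0 andbT -x0.
apply: le_trans (l1_partial_le _ i.+1).
by rewrite /l1_partial big_ord_recr lerDr l1_partial_ge0.
Qed.

HB.instance Definition _ :=
  Lmodule_isNormed.Build K ell1 l1_normD l1_normZ l1_norm0_eq0.

Lemma l1_complete (F : set_system ell1) : ProperFilter F -> cauchy F -> cvg F.
Proof.
apply: (@range_sup_norm_complete K ell1 nat nat (fun x => val x)
  (fun n f => l1_partial f n)).
- exact: cauchy_completeP.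
- by [].
- move=> t; exists t.+1 => f.
  by rewrite /l1_partial big_ord_recr lerDr l1_partial_ge0.
- exact: l1_partial_le.
- exact: l1_norm_le.
- by move=> n f g; exact: l1_partialD.
- move=> n; exists (iota 0 n) => f.
  by rewrite /l1_partial -(big_mkord xpredT (fun i => `|f i|)) /index_iota subn0.
- move=> f fx; have [x fx1] := fx 1 ltr01.
  suff f1 : f \in l1_pred by exists (exist _ f f1).
  apply/asboolP; exists (1 + `|x|) => n.
  apply: le_trans (lerD (fx1 n) (l1_partial_le x n)).
  rewrite /l1_partial -big_split; apply: ler_sum => i _ /=.
  by rewrite -{1}[f i](subKr (val x i)) addrC ler_normB.
Qed.

HB.instance Definition _ := Uniform_isComplete.Build ell1 l1_complete.
End ell1.

(* The completed injective tensor power of [X]. The elementary tensor of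
   x_1, ..., x_n is identified with the function
   (phi_1, ..., phi_n) |-> phi_1(x_1) * ... * phi_n(x_n) on the n-th power of the
   closed unit ball of the dual of [X]; as functionals separate points, this
   embeds the algebraic tensor power into the bounded scalar functions on that
   set, and the injective norm
     || u || = sup { |(phi_1 (x) ... (x) phi_n)(u)| : ||phi_i|| <= 1 }
   is the induced sup norm. Since the bounded functions form a Banach space, the
   completion is the closure, for uniform convergence, of the span of the
   elementary tensors. For n = 1 this is the canonical copy of a Banach space
   [X] in its bidual. *)
Section inj_tensor_power.
Variables (K : scalarFieldType) (X : normedModType K) (n : nat).

Record dual_ball := DualBall {
  dual_fun :> {scalar X} ;
  dual_le1 : forall x, `|dual_fun x| <= `|x|
}.

Definition elem_tensor (x : 'I_n -> X) (phi : 'I_n -> dual_ball) : K^o :=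
  \prod_(i < n) phi i (x i).

Definition tensor_comb (s : seq (K * ('I_n -> X))) (phi : 'I_n -> dual_ball) : K^o :=
  \sum_(t <- s) t.1 *: elem_tensor t.2 phi.

Definition inj_pred : {pred ('I_n -> dual_ball) -> K^o} := [pred u | `[<
  forall e : K, 0 < e -> exists s, forall phi, `|u phi - tensor_comb s phi| <= e >]].

Lemma elem_tensor_le x phi : `|elem_tensor x phi| <= \prod_(i < n) `|x i|.
Proof.
by rewrite normr_prod; apply: ler_prod => i _; rewrite normr_ge0 dual_le1.
Qed.

Lemma tensor_combZD a s t phi :
  tensor_comb ([seq (a * c.1, c.2) | c <- s] ++ t) phi =
  a * tensor_comb s phi + tensor_comb t phi.
Proof.
rewrite /tensor_comb big_cat big_map; congr +%R.
by rewrite mulr_sumr; apply: eq_bigr => c _; exact/esym/mulrA.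
Qed.

Lemma inj_submod_closed : submod_closed inj_pred.
Proof.
split=> [|a u v].
  apply/asboolP => e e0; exists [::] => phi.
  by rewrite /tensor_comb big_nil subrr normr0 ltW.
move=> /asboolP us /asboolP vt; apply/asboolP => e e0.
have a0 : 0 < `|a| + 1 by rewrite ltr_wpDl.
have e20 : 0 < e / 2 by rewrite divr_gt0.
have [s us'] := us (e / 2 / (`|a| + 1)) (divr_gt0 e20 a0).
have [t vt'] := vt _ e20.
exists ([seq (a * c.1, c.2) | c <- s] ++ t) => phi.
rewrite tensor_combZD opprD addrACA [leRHS]splitr.
apply: le_trans (ler_normD _ _) _; apply: lerD; last exact: vt'.
rewrite -mulrBr normrM; apply: le_trans (ler_wpM2l (normr_ge0 _) (us' phi)) _.
rewrite mulrCA ler_piMr ?(ltW e20)// ler_pdivrMr// mul1r lerDl//.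
Qed.

HB.instance Definition _ := GRing.isSubmodClosed.Build _ _ inj_pred
  inj_submod_closed.

Definition inj_tensor_power := {u : ('I_n -> dual_ball) -> K^o | u \in inj_pred}.

HB.instance Definition _ := SubChoice.on inj_tensor_power.
HB.instance Definition _ := [SubChoice_isSubLmodule of inj_tensor_power by <:].

Definition inj_norm (u : inj_tensor_power) : K := range_sup (fun phi => `|val u phi|).

Lemma zero_dual_subproof (x : X) : `|(\0 : X -> K^o) x| <= `|x|.
Proof. by rewrite normr0. Qed.

Definition zero_dual : dual_ball := @DualBall (\0 : X -> K^o) zero_dual_subproof.

Let phi0 : 'I_n -> dual_ball := fun=> zero_dual.

Lemma inj_bounded (u : inj_tensor_power) : exists M, forall phi, `|val u phi| <= M.
Proof.
have /asboolP/(_ _ ltr01)[s us] := valP u.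
exists (1 + \sum_(t <- s) `|t.1| * \prod_(i < n) `|t.2 i|) => phi.
rewrite -(subrK (tensor_comb s phi) (val u phi)).
apply: le_trans (ler_normD _ _) _; apply: lerD => //.
apply: le_trans (ler_norm_sum _ _ _) _; apply: ler_sum => t _.
by rewrite normrM ler_wpM2l// elem_tensor_le.
Qed.

Lemma inj_norm_ub (u : inj_tensor_power) phi : `|val u phi| <= inj_norm u.
Proof.
by apply: (@range_sup_ub _ _ phi0 (fun phi => `|val u phi|)) => //;
  exact: inj_bounded.
Qed.

Lemma inj_norm_le (u : inj_tensor_power) M :
  (forall phi, `|val u phi| <= M) -> inj_norm u <= M.
Proof.
by apply: (@range_sup_le _ _ phi0 (fun phi => `|val u phi|)) => //;
  exact: inj_bounded.
Qed.

Lemma inj_normD (u v : inj_tensor_power) : inj_norm (u + v) <= inj_norm u + inj_norm v.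
Proof.
apply: inj_norm_le => phi; apply: le_trans (ler_normD _ _) _.
by rewrite lerD ?inj_norm_ub.
Qed.

Lemma inj_normZ (a : K) (u : inj_tensor_power) : inj_norm (a *: u) = `|a| * inj_norm u.
Proof.
rewrite -(@range_supZ _ _ phi0 (fun phi => `|val u phi|))//; last exact: inj_bounded.
by congr range_sup; apply/funext => phi; exact: normrM.
Qed.

Lemma inj_norm0_eq0 (u : inj_tensor_power) : inj_norm u = 0 -> u = 0.
Proof.
move=> u0; apply: val_inj; apply/funext => phi /=.
by apply/normr0_eq0/le_anti; rewrite normr_ge0 andbT -u0 inj_norm_ub.
Qed.

HB.instance Definition _ :=
  Lmodule_isNormed.Build K inj_tensor_power inj_normD inj_normZ inj_norm0_eq0.

Lemma inj_complete (F : set_system inj_tensor_power) :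
  ProperFilter F -> cauchy F -> cvg F.
Proof.
apply: (@range_sup_norm_complete K inj_tensor_power _ _ (fun u => val u)
  (fun phi f => `|f phi|)).
- exact: cauchy_completeP.
- by [].
- by move=> phi; exists phi.
- exact: inj_norm_ub.
- exact: inj_norm_le.
- by move=> phi f g; exact: ler_normD.
- by move=> phi; exists [:: phi] => f; rewrite big_seq1.
- move=> f fu; suff f1 : f \in inj_pred by exists (exist _ f f1).
  apply/asboolP => e e0; have e20 : 0 < e / 2 by rewrite divr_gt0.
  have [u fu2] := fu _ e20; have /asboolP/(_ _ e20)[s us] := valP u.
  exists s => phi; rewrite -(subrKA (val u phi)) [leRHS]splitr.
  apply: le_trans (ler_normD _ _) _; apply: lerD => //.
  by rewrite distrC; exact: fu2.
Qed.

HB.instance Definition _ := Uniform_isComplete.Build inj_tensor_power inj_complete.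

End inj_tensor_power.

Definition is_subspace (K : numFieldType) (E : normedModType K) (Y : set E) :=
  [/\ closed Y, Y 0 & forall (a : K) (u v : E), Y u -> Y v -> Y (a *: u + v)].

(* [f] is a linear homeomorphism of [E] onto [Y], with inverse [g]; the values of
   [g] outside [Y] are irrelevant. *)
Definition isomorphic_onto (K : numFieldType) (E F : normedModType K) (Y : set F) :=
  exists f : {linear E -> F}, exists g : F -> E,
    [/\ continuous f, range f = Y, cancel f g & {within Y, continuous g}].

Definition isomorphic_to_subspace (K : numFieldType) (E F : normedModType K) :=
  exists Y : set F, is_subspace Y /\ isomorphic_onto E Y.

(* Main.v *)
From HB Require Import structures.
Require Import Defs.
From mathcomp Require Import all_boot all_order all_algebra.
From mathcomp Require Import complex ring.
From mathcomp Require Import boolp classical_sets functions reals topology normedtype.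

(* If T embeds the n-th power into the m-th, the tensors y_x = T(x_1 (x) ... (x) x_n),
   where each x_i is one of countably many unit vectors, satisfy
     |sum_x a_x psi(y_x)| <= C sup_phi sum_x |a_x| |phi_1(x_1)| ... |phi_n(x_n)|
   for psi = psi_1 (x) ... (x) psi_m with psi_k in the unit ball of c_00, and each
   y_x is bounded below on some such psi. One vector slot can then be traded for
   one functional slot. The normalised Rademacher vectors r_1, ..., r_k of l_1
   satisfy sum_s |phi(r_s)| <= sqrt k (Dvoretzky-Rogers), so for fixed x_2, ..., x_n
   some choice x_1 = r_s makes y_x small on any given finite set of coordinates;
   hence |psi(y_x)| is bounded below for some psi having one factor supported far
   out. Doing this for all (x_2, ..., x_n), which are countably many, with
   disjointly supported factors, and gluing those factors with random signs, gives
   the same situation with n - 1 and m - 1. This is impossible once m = 0 < n, where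
   Dvoretzky-Rogers contradicts the lower bound. *)

Set Implicit Arguments.
Unset Strict Implicit.
Unset Printing Implicit Defensive.

Import Order.TTheory GRing.Theory Num.Theory.
Import numFieldNormedType.Exports.

Local Open Scope classical_set_scope.
Local Open Scope ring_scope.

(** * Forms in several finitely supported functionals *)

Section slots.
Variables (K : numFieldType) (I : finType).
Implicit Types (psi : I -> {poly K}) (g : (I -> {poly K}) -> K) (p q : {poly K}).

(* Polynomials stand for the elements of c_00, with the sup norm of coefficients. *)
Definition unit_poly p := forall i, `|p`_i| <= 1.

Definition unit_args psi := forall k, unit_poly (psi k).

Definition set_arg psi k p : I -> {poly K} := fun i => if i == k then p else psi i.

(** Linearity is asked only inside the unit ball: outside it [poly_dual] is [zero_dual], and
    linearity can fail there. *)
Definition slot_linear g k := forall psi a p q, unit_args psi ->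
  unit_poly p -> unit_poly q -> unit_poly (a *: p + q) ->
  g (set_arg psi k (a *: p + q)) = a * g (set_arg psi k p) + g (set_arg psi k q).

Definition slot_const g k := forall psi p, g (set_arg psi k p) = g psi.

Definition multilinear_on (A : {set I}) g :=
  forall k, if k \in A then slot_linear g k else slot_const g k.

Lemma set_argK psi k : set_arg psi k (psi k) = psi.
Proof. by apply/funext => i; rewrite /set_arg; case: eqP => [->|]. Qed.

Lemma set_arg_set psi k p q : set_arg (set_arg psi k p) k q = set_arg psi k q.
Proof. by apply/funext => i; rewrite /set_arg; case: eqP. Qed.

Lemma set_argC psi k l p q : k != l ->
  set_arg (set_arg psi k p) l q = set_arg (set_arg psi l q) k p.
Proof.
move=> kl; apply/funext => i; rewrite /set_arg.
by have [->|//] := eqVneq i l; rewrite eq_sym (negPf kl).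
Qed.

Lemma unit_poly0 : unit_poly 0.
Proof. by move=> i; rewrite coef0 normr0. Qed.

Lemma unit_polyXn n : unit_poly 'X^n.
Proof. by move=> i; rewrite coefXn; case: eqP; rewrite ?normr1 ?normr0. Qed.

Lemma unit_take_poly n p : unit_poly p -> unit_poly (take_poly n p).
Proof. by move=> pu i; rewrite coef_take_poly; case: ifP; rewrite ?normr0. Qed.

Lemma unit_sub_take_poly n p : unit_poly p -> unit_poly (p - take_poly n p).
Proof.
move=> pu i; rewrite coefB coef_take_poly; case: ifP => _.
  by rewrite subrr normr0.
by rewrite subr0.
Qed.

Lemma unit_set_arg psi k p : unit_args psi -> unit_poly p -> unit_args (set_arg psi k p).
Proof. by move=> psiu pu i; rewrite /set_arg; case: eqP. Qed.

Lemma slot_linear0 g k psi : slot_linear g k -> unit_args psi -> g (set_arg psi k 0) = 0.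
Proof.
move=> gk psiu; have u0 := unit_poly0.
have := gk psi 1 0 0 psiu u0 u0; rewrite scaler0 addr0 mul1r => /(_ u0) /eqP.
by rewrite eq_sym -subr_eq0 addrK => /eqP.
Qed.

(** The monomial expansion of slot [k] has coefficients of modulus at most 1. In a constant slot the
    term [i = 0] alone gives the bound, whence [0 < N]. *)
Lemma slot_le_monomials A g k N psi : multilinear_on A g -> unit_args psi ->
  (0 < N)%N -> (size (psi k) <= N)%N ->
  `|g psi| <= \sum_(0 <= i < N) `|g (set_arg psi k 'X^i)|.
Proof.
move=> gA psiu N0 sN; have := gA k; case: ifP => _ gk; last first.
  by rewrite big_ltn// gk lerDl sumr_ge0.
rewrite -{1}(set_argK psi k) -(take_poly_id sN).
elim: N {N0 sN} => [|N IH].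
  by rewrite take_poly0l slot_linear0// normr0 big_geq.
have := unit_take_poly N (psiu k); have := unit_take_poly N.+1 (psiu k).
have -> : take_poly N.+1 (psi k) = (psi k)`_N *: 'X^N + take_poly N (psi k).
  apply/polyP => i; rewrite coefD coefZ coefXn !coef_take_poly ltnS leq_eqVlt.
  by case: ltngtP => [||->] /=; rewrite ?mulr0 ?add0r ?mulr1 ?addr0.
move=> u1 u2; rewrite gk//; last exact: unit_polyXn.
rewrite big_nat_recr//= addrC; apply: le_trans (ler_normD _ _) _.
by rewrite lerD// normrM ler_piMl// psiu.
Qed.

Fixpoint monomials N (ks : seq I) psi : seq (I -> {poly K}) :=
  if ks is k :: ks' then
    flatten [seq monomials N ks' (set_arg psi k 'X^i) | i <- index_iota 0 N]
  else [:: psi].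

(** When [ks] lists all of [I], the list does not depend on [psi]: finitely many evaluations control
    a form on all arguments of size at most [N]. *)
Lemma monomials_eq N ks psi psi' :
  (forall i, i \notin ks -> psi i = psi' i) -> monomials N ks psi = monomials N ks psi'.
Proof.
elim: ks psi psi' => [|k ks IH] psi psi' h /=.
  by congr [:: _]; apply/funext => i; exact: h.
congr flatten; apply: eq_map => j; apply: IH => i iks; rewrite /set_arg.
by case: eqVneq => // ik; apply: h; rewrite inE negb_or ik.
Qed.

Lemma unit_monomials N ks psi : unit_args psi ->
  {in monomials N ks psi, forall chi, unit_args chi}.
Proof.
elim: ks psi => [|k ks IH] psi psiu chi /=; first by rewrite inE => /eqP ->.
move=> /flattenP[_ /mapP[j _ ->]]; apply: IH.
by apply: unit_set_arg => //; exact: unit_polyXn.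
Qed.

Lemma le_monomials A g N ks psi : multilinear_on A g -> unit_args psi ->
  (0 < N)%N -> (forall k, k \in ks -> (size (psi k) <= N)%N) ->
  `|g psi| <= \sum_(chi <- monomials N ks psi) `|g chi|.
Proof.
move=> gA psiu N0; elim: ks psi psiu => [|k ks IH] psi psiu sN /=.
  by rewrite big_seq1.
rewrite big_flatten big_map.
have sNk : (size (psi k) <= N)%N by apply: sN; rewrite mem_head.
apply: le_trans (slot_le_monomials gA psiu N0 sNk) _.
apply: ler_sum_nat => i /andP[_ iN]; apply: IH.
  by apply: unit_set_arg => //; exact: unit_polyXn.
move=> l lks; rewrite /set_arg; case: eqP => _; first by rewrite size_polyXn.
by apply: sN; rewrite inE lks orbT.
Qed.

Definition take_args N (ks : seq I) psi : I -> {poly K} :=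
  fun i => if i \in ks then take_poly N (psi i) else psi i.

Lemma unit_take_args N ks psi : unit_args psi -> unit_args (take_args N ks psi).
Proof.
by move=> psiu i; rewrite /take_args; case: ifP => // _; exact: unit_take_poly.
Qed.

(** Slots are truncated one after the other; each truncation loses at most a term with a tail in
    that slot. *)
Lemma le_take_args A g N d ks psi : multilinear_on A g -> unit_args psi -> uniq ks ->
  0 <= d ->
  (forall k chi, k \in A -> unit_args chi ->
    `|g (set_arg chi k (chi k - take_poly N (chi k)))| <= d) ->
  `|g psi| <= `|g (take_args N ks psi)| + d * (size ks)%:R.
Proof.
move=> gA psiu + d0 gd; elim: ks => [|k ks IH] /=; first by rewrite mulr0 addr0.
move=> /andP[kks /IH{IH} IH]; apply: le_trans IH _.
set chi := take_args N ks psi.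
have chiu : unit_args chi by exact: unit_take_args.
have -> : take_args N (k :: ks) psi = set_arg chi k (take_poly N (chi k)).
  apply/funext => i; rewrite /chi/take_args/set_arg inE.
  by have [->|//] := eqVneq i k; rewrite (negPf kks).
rewrite -natr1 mulrDr mulr1 addrA addrAC lerD2r.
have := gA k; have [kA|kA] := boolP (k \in A) => gk; last by rewrite gk lerDl.
have {1}-> : chi = set_arg chi k (1 *: take_poly N (chi k) + (chi k - take_poly N (chi k))).
  by rewrite scale1r addrC subrK set_argK.
rewrite gk//; first last.
- by rewrite scale1r addrC subrK; exact: chiu.
- exact: unit_sub_take_poly.
- exact: unit_take_poly.
by rewrite mul1r; apply: le_trans (ler_normD _ _) _; rewrite lerD2l; exact: gd.
Qed.

End slots.

(** * Trading a vector slot for a functional slot *)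

Section families.
Variables (K : numFieldType) (I : finType).
Implicit Types (psi : I -> {poly K}) (g : (I -> {poly K}) -> K) (p q : {poly K}).

Definition subunit (L : Type) (W : set (L -> K)) :=
  forall w, W w -> forall x, 0 <= w x <= 1.

Definition prod_weights (U L : Type) (V : set (U -> K)) (W : set (L -> K)) :
  set (U * L -> K) :=
  [set w | exists v w', [/\ V v, W w' & forall x, w x = v x.1 * w' x.2]].

(** The comparison is with every upper bound [B], because a supremum over [W] need not exist in a
    general [K]. *)
Definition dominated (L : eqType) (W : set (L -> K))
    (y : L -> (I -> {poly K}) -> K) (C : K) :=
  forall (s : seq L) (a : L -> K) (B : K) psi, uniq s ->
    (forall w, W w -> \sum_(x <- s) `|a x| * w x <= B) -> unit_args psi ->
    `|\sum_(x <- s) a x * y x psi| <= C * B.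

(** The Dvoretzky-Rogers property in terms of weights: finitely many vectors on which all
    functionals are uniformly small on average. *)
Definition small_averages (U : eqType) (V : set (U -> K)) :=
  forall e : K, 0 < e -> exists s : seq U,
    [/\ uniq s, s != [::] & forall v, V v -> \sum_(u <- s) v u <= e * (size s)%:R].

Lemma sumr_seq_const (T : Type) (s : seq T) (c : K) : \sum_(x <- s) c = c *+ size s.
Proof. by rewrite big_const_seq count_predT iter_addr_0. Qed.

Definition phase (z : K) : K := if z == 0 then 0 else `|z| / z.

Lemma phaseM z : phase z * z = `|z|.
Proof. by rewrite /phase; case: eqVneq => [->|z0]; rewrite ?mul0r ?normr0// divfK. Qed.

Lemma phase_le1 z : `|phase z| <= 1.
Proof.
rewrite /phase; case: eqVneq => [_|z0]; first by rewrite normr0.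
by rewrite normrM normr_id normfV divff// normr_eq0.
Qed.

(** Domination with phases as coefficients makes the average of [|y (u, x) psi|] over suitable [u]
    small for each [psi]; some [u] does no worse than the average of the sum over [Psi]. *)
Lemma exists_small_label (U L : eqType) (V : set (U -> K)) (W : set (L -> K)) y C
    (Psi : seq (I -> {poly K})) (x : L) (e : K) :
  small_averages V -> subunit V -> subunit W ->
  dominated (prod_weights V W) y C -> 0 <= C ->
  {in Psi, forall psi, unit_args psi} -> 0 < e ->
  exists u, \sum_(psi <- Psi) `|y (u, x) psi| <= e.
Proof.
move=> Vs V1 W1 yC C0 Psiu e0.
pose D := (size Psi)%:R * C.
have D0 : 0 <= D by rewrite mulr_ge0.
have D10 : 0 < D + 1 by rewrite ltr_wpDl.
(* The final average is at most [D * (e / (D + 1))], which is below [e]; adding 1 also covers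
   [D = 0]. *)
have [s [su s0 sV]] := Vs (e / (D + 1)) (divr_gt0 e0 D10).
have sz : 0 < (size s)%:R :> K by rewrite ltr0n lt0n size_eq0.
have key psi : unit_args psi ->
    \sum_(u <- s) `|y (u, x) psi| <= C * (e / (D + 1) * (size s)%:R).
  move=> psiu.
  pose s' := [seq (u, x) | u <- s].
  have su' : uniq s' by rewrite map_inj_uniq// => ? ? [].
  have hB w : prod_weights V W w ->
      \sum_(t <- s') `|phase (y t psi)| * w t <= e / (D + 1) * (size s)%:R.
    move=> [v [w' [Vv Ww' ww]]]; apply: le_trans (sV _ Vv).
    rewrite big_map; apply: ler_sum => u _; rewrite ww/=.
    have /andP[v0 _] := V1 _ Vv u; have /andP[w0 w1] := W1 _ Ww' x.
    apply: le_trans (_ : v u * w' x <= _); last by rewrite ler_piMr.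
    by rewrite ler_piMl ?mulr_ge0// phase_le1.
  have := yC s' (fun t => phase (y t psi)) _ psi su' hB psiu.
  rewrite big_map (eq_bigr (fun v => `|y (v, x) psi|)) => [|v _]; last exact: phaseM.
  by rewrite ger0_norm// sumr_ge0.
apply/not_existsP => h.
have h2 u : e <= \sum_(psi <- Psi) `|y (u, x) psi|.
  have ur : \sum_(psi <- Psi) `|y (u, x) psi| \is Num.real.
    by rewrite ger0_real// sumr_ge0.
  by have /negP := h u; rewrite -real_ltNge// ?gtr0_real//; exact: ltW.
have : e * (size s)%:R <= D * (e / (D + 1) * (size s)%:R).
  apply: (@le_trans _ _ (\sum_(u <- s) \sum_(psi <- Psi) `|y (u, x) psi|)).
    rewrite mulr_natr -sumr_seq_const; apply: ler_sum => v _; exact: h2.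
  rewrite exchange_big/= /D -mulrA mulr_natl -sumr_seq_const.
  by rewrite big_seq [leRHS]big_seq; apply: ler_sum => psi /Psiu; exact: key.
apply/negP; rewrite lt_geF// mulrA ltr_pM2r// mulrA ltr_pdivrMr// mulrC.
by rewrite ltr_pM2l// ltrDl.
Qed.

Definition bounded_below (L : Type) (y : L -> (I -> {poly K}) -> K) (c : K) :=
  forall x, exists2 psi, unit_args psi & c <= `|y x psi|.

(** Choose [u] so that [y (u, x)] is at most [c / 2] in total on monomials of degree at most [N]. As
    the form reaches [c] somewhere, truncating its arguments must lose something, so some slot
    accepts a tail keeping the form large. The triple [d] consists of [u], that slot and that
    tail. *)
Lemma exists_tail_slot (U L : eqType) (V : set (U -> K)) (W : set (L -> K)) y C c
    (A : U * L -> {set I}) (x : L) N :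
  small_averages V -> subunit V -> subunit W ->
  dominated (prod_weights V W) y C -> 0 <= C ->
  bounded_below y c -> 0 < c ->
  (forall t, multilinear_on (A t) (y t)) ->
  exists d : U * I * {poly K},
    [/\ d.1.2 \in A (d.1.1, x), unit_poly d.2, forall j, (j < N)%N -> d.2`_j = 0 &
      exists2 psi, unit_args psi &
        c / (2 * (#|I|.+1)%:R) <= `|y (d.1.1, x) (set_arg psi d.1.2 d.2)|].
Proof.
move=> Vs V1 W1 yC C0 yc c0 yA.
have c20 : 0 < c / 2 by rewrite divr_gt0.
have unit0 : @unit_args K I (fun=> 0) by move=> k; exact: unit_poly0.
have [u hu] := exists_small_label x Vs V1 W1 yC C0
  (@unit_monomials K I N.+1 (enum I) _ unit0) c20.
have [psi psiu cpsi] := yc (u, x).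
apply/not_existsP => h.
(* The [#|I|] truncations cost at most [d] each, in total strictly less than [c / 2]. *)
set d := c / (2 * (#|I|.+1)%:R) in h.
have d0 : 0 < d by rewrite divr_gt0// mulr_gt0.
have hd k chi : k \in A (u, x) -> unit_args chi ->
    `|y (u, x) (set_arg chi k (chi k - take_poly N.+1 (chi k)))| <= d.
  move=> kA chiu; have /= := h (u, k, chi k - take_poly N.+1 (chi k)).
  rewrite real_leNgt ?normr_real ?gtr0_real//; apply: contra_notN => dlt; split => //.
  - exact: unit_sub_take_poly.
  - by move=> j jN; rewrite coefB coef_take_poly ltnS (ltnW jN) subrr.
  - by exists chi => //; exact: ltW.
have := le_take_args (yA (u, x)) psiu (enum_uniq I) (ltW d0) hd.
apply/negP; rewrite lt_geF//; apply: lt_le_trans cpsi.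
set chi := take_args _ _ _.
have chiu : unit_args chi by exact: unit_take_args.
have chis k : k \in enum I -> (size (chi k) <= N.+1)%N.
  by move=> kI; rewrite /chi /take_args kI size_take_poly.
have := le_monomials (yA (u, x)) chiu (ltn0Sn N) chis.
rewrite (@monomials_eq _ _ _ _ _ (fun=> 0)); last by move=> i; rewrite mem_enum.
move=> /le_trans/(_ hu) le2; rewrite [ltRHS]splitr.
apply: ler_ltD le2 _; rewrite -cardE /d invfM -!mulrA [_^-1 * #|I|%:R]mulrC mulrA gtr_pMr//.
by rewrite ltr_pdivrMr// mul1r ltr_nat.
Qed.

(* Averaging over the signs [th] removes the off-diagonal terms; the induction
   averages over one sign at a time. *)
Lemma diag_le_signs (L : eqType) (s : seq L) (b : L -> L -> K) (D B : K) : uniq s ->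
  (forall th : L -> K, (forall x, th x = 1 \/ th x = -1) ->
    `|D + \sum_(x <- s) \sum_(x' <- s) th x * th x' * b x x'| <= B) ->
  `|D + \sum_(x <- s) b x x| <= B.
Proof.
(* [D] holds the diagonal terms already split off, so it varies in the induction. *)
elim: s D => [|x0 s IH] D /=.
  move=> _ /(_ (fun=> 1)); rewrite !big_nil; apply; by left.
move=> /andP[x0s us] h; rewrite big_cons addrA; apply: IH => // th thE.
pose th1 (e : K) x := if x == x0 then e else th x.
have thE1 e : e = 1 \/ e = -1 -> forall x, th1 e x = 1 \/ th1 e x = -1.
  by move=> eE x; rewrite /th1; case: eqP.
pose S := \sum_(x <- s) \sum_(x' <- s) th x * th x' * b x x'.
pose R := \sum_(x <- s) th x * (b x x0 + b x0 x).
(* The sign [e] of [x0] multiplies only the cross terms [R]; the choices 1 and -1 then average [R]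
   away. *)
have E e : e * e = 1 ->
    D + \sum_(x <- x0 :: s) \sum_(x' <- x0 :: s) th1 e x * th1 e x' * b x x' =
    (D + b x0 x0 + S) + e * R.
  move=> e2.
  have sE (f g : L -> K) : (forall x, x != x0 -> f x = g x) ->
      \sum_(x <- s) f x = \sum_(x <- s) g x.
    move=> fg; rewrite big_seq [RHS]big_seq; apply: eq_bigr => x xs.
    by apply: fg; apply: contraNneq x0s => <-.
  have -> : \sum_(x <- x0 :: s) \sum_(x' <- x0 :: s) th1 e x * th1 e x' * b x x' =
      b x0 x0 + \sum_(x <- s) e * th x * b x0 x +
      \sum_(x <- s) (e * th x * b x x0 + \sum_(x' <- s) th x * th x' * b x x').
    rewrite big_cons big_cons {1 2}/th1 eqxx e2 mul1r; congr (_ + _ + _).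
      by apply: sE => x /negPf xx0; rewrite /th1 eqxx xx0.
    apply: (sE) => x /negPf xx0; rewrite big_cons {1 2}/th1 eqxx xx0; congr (_ + _).
      by rewrite mulrC [th x * e]mulrC mulrC.
    by apply: sE => x' /negPf xx'; rewrite /th1 xx0 xx'.
  rewrite big_split/= -/S /R mulr_sumr.
  under [in RHS]eq_bigr do rewrite mulrDr mulrDr !mulrA.
  rewrite big_split/=; ring.
have h1 : `|D + b x0 x0 + S + R| <= B.
  by have := h _ (thE1 1 (or_introl erefl)); rewrite E ?mulr1// mul1r.
have h2 : `|D + b x0 x0 + S - R| <= B.
  by have := h _ (thE1 (-1) (or_intror erefl)); rewrite E ?mulrNN ?mulr1// mulN1r.
have two : 0 < 2 :> K by [].
rewrite -/S -(ler_pM2l two) -[X in X * `|_|]ger0_norm// -normrM.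
have -> : 2 * (D + b x0 x0 + S) = (D + b x0 x0 + S + R) + (D + b x0 x0 + S - R) by ring.
by apply: le_trans (ler_normD _ _) _; rewrite mulr_natl mulr2n lerD.
Qed.


(** Running through [L] in the order of [pickle], each [M x] is at least the sizes of all tails
    chosen earlier; tails vanishing below [M x] then have disjoint supports. *)
Lemma disjoint_tails (L : countType) (T : Type) (size' : T -> nat) (G : L -> nat -> T) :
  exists M : L -> nat, forall x x', x != x' ->
    (size' (G x (M x)) <= M x')%N \/ (size' (G x' (M x')) <= M x)%N.
Proof.
pose fix M i := if i is j.+1 then
  if unpickle j is Some x then maxn (M j) (size' (G x (M j))) else M j else 0%N.
have Mle i j : (i <= j)%N -> (M i <= M j)%N.
  elim: j => [|j IH]; first by rewrite leqn0 => /eqP ->.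
  rewrite leq_eqVlt => /predU1P[->//|/IH Mij]; apply: leq_trans Mij _ => /=.
  by case: unpickle => // x; rewrite leq_maxl.
have Mlt x x' : (pickle x < pickle x')%N -> (size' (G x (M (pickle x))) <= M (pickle x'))%N.
  by move=> /Mle; apply: leq_trans => /=; rewrite pickleK leq_maxr.
exists (M \o pickle) => x x' xx' /=.
have : pickle x != pickle x' by apply: contraNneq xx' => /(pcan_inj pickleK) ->.
by rewrite neq_ltn => /orP[] /Mlt; [left|right].
Qed.

(** At each index at most one summand is nonzero, so gluing does not increase the sup norm. *)
Lemma unit_signed_sum (L : eqType) (s : seq L) (f : L -> {poly K}) (th : L -> K) :
  uniq s -> (forall x, th x = 1 \/ th x = -1) -> (forall x, unit_poly (f x)) ->
  (forall x x' j, x != x' -> (f x)`_j = 0 \/ (f x')`_j = 0) ->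
  unit_poly (\sum_(x <- s) th x *: f x).
Proof.
move=> us thE fu fd j; rewrite coef_sum.
have [[x xs fx]|h] := pselect (exists2 x, x \in s & (f x)`_j != 0); last first.
  rewrite big_seq big1 ?normr0// => x xs; rewrite coefZ.
  have [->|fx] := eqVneq (f x)`_j 0; first by rewrite mulr0.
  by case: h; exists x.
rewrite (bigD1_seq x)//= big1 => [|x' x'x].
  by rewrite addr0 coefZ normrM; case: (thE x) => ->; rewrite ?normrN normr1 mul1r; exact: fu.
by rewrite coefZ; case: (fd x' x j x'x) => [->|/eqP]; rewrite ?mulr0// (negPf fx).
Qed.

(** By disjointness every partial sum stays in the unit ball, as [slot_linear] requires. *)
Lemma slot_linear_sum (L : eqType) (s : seq L) (f : L -> {poly K}) (th : L -> K)
    g k psi :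
  uniq s -> (forall x, th x = 1 \/ th x = -1) -> (forall x, unit_poly (f x)) ->
  (forall x x' j, x != x' -> (f x)`_j = 0 \/ (f x')`_j = 0) ->
  slot_linear g k -> unit_args psi ->
  g (set_arg psi k (\sum_(x <- s) th x *: f x)) =
    \sum_(x <- s) th x * g (set_arg psi k (f x)).
Proof.
move=> + thE fu fd gk psiu; elim: s => [|x s IH].
  by rewrite !big_nil slot_linear0.
move=> us; have := unit_signed_sum us thE fu fd; move: us => /= /andP[xs us].
by rewrite !big_cons => u; rewrite gk// ?IH//; exact: unit_signed_sum.
Qed.

(* [A x] is the set of functional slots of [y x] that have not been traded yet;
   [y x] does not depend on the others. *)
Variant separated_family (L : eqType) (W : set (L -> K)) (m : nat) : Prop :=
  SeparatedFamily (y : L -> (I -> {poly K}) -> K) (A : L -> {set I}) (C c : K) of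
    0 <= C & 0 < c & dominated W y C & bounded_below y c &
    (forall x, (#|A x| <= m)%N) & (forall x, multilinear_on (A x) (y x)).

(** Fixing the tail [f x] in slot [k x] of [y (u x, x)] keeps a lower bound and removes one slot.
    For domination, the tails are glued with signs into one unit argument; averaging over signs
    leaves only the terms where [x] meets its own tail. *)
Lemma separated_family_step (U L : countType) (V : set (U -> K)) (W : set (L -> K)) m :
  small_averages V -> subunit V -> subunit W ->
  separated_family (prod_weights V W) m.+1 -> separated_family W m.
Proof.
move=> Vs V1 W1 [y A C c C0 c0 yC yc Am yA].
have [G GP] := boolp.choice (fun t : L * nat =>
  exists_tail_slot t.1 t.2 Vs V1 W1 yC C0 yc c0 yA).
have [M MP] := disjoint_tails (fun d : U * I * {poly K} => size d.2) (fun x N => G (x, N)).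
pose u x := (G (x, M x)).1.1; pose k x := (G (x, M x)).1.2; pose f x := (G (x, M x)).2.
have kA x : k x \in A (u x, x) by case: (GP (x, M x)).
have fu x : unit_poly (f x) by case: (GP (x, M x)).
have f0 x j : (j < M x)%N -> (f x)`_j = 0 by case: (GP (x, M x)) => _ _ + _; apply.
have fd x x' j : x != x' -> (f x)`_j = 0 \/ (f x')`_j = 0.
  have tail z z' : (size (f z) <= M z')%N -> (f z)`_j = 0 \/ (f z')`_j = 0.
    move=> zz'; have [jz|jz] := ltnP j (size (f z)); last by left; rewrite nth_default.
    by right; apply: f0; exact: leq_trans zz'.
  by move=> /MP[/tail//|/tail[]]; [right|left].
pose y' x psi := y (u x, x) (set_arg psi (k x) (f x)).
exists y' (fun x => A (u x, x) :\ k x) (#|I|%:R * C) (c / (2 * (#|I|.+1)%:R)).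
- by rewrite mulr_ge0.
- by rewrite divr_gt0// mulr_gt0.
- move=> s a B psi us sB psiu.
  (* Labels are grouped by the slot that they lose, so that one glued argument serves a whole group;
     this costs the factor [#|I|]. *)
  have -> : \sum_(x <- s) a x * y' x psi =
      \sum_(i : I) \sum_(x <- [seq x <- s | k x == i]) a x * y' x psi.
    under [RHS]eq_bigr do rewrite big_filter big_mkcond.
    rewrite exchange_big/=; apply: eq_bigr => x _.
    by rewrite -big_mkcond (big_pred1 (k x)) // => i; rewrite eq_sym.
  apply: le_trans (ler_norm_sum _ _ _) _.
  have -> : #|I|%:R * C * B = \sum_(i : I) C * B by rewrite sumr_const -mulrA mulr_natl.
  apply: ler_sum => i _.
  set si := [seq _ <- _ | _]; have usi : uniq si by exact: filter_uniq.
  rewrite -[X in `|X|]add0r.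
  have -> : \sum_(x <- si) a x * y' x psi =
      \sum_(x <- si) a x * y (u x, x) (set_arg psi i (f x)).
    rewrite big_seq [RHS]big_seq; apply: eq_bigr => x.
    by rewrite mem_filter => /andP[/eqP <- _].
  (* The wanted sum is the diagonal of the double sum pairing the form of [x] with the tail of
     [x']. *)
  apply: (diag_le_signs (b := fun x x' => a x * y (u x, x) (set_arg psi i (f x'))) usi).
  move=> th thE; rewrite add0r.
  have -> : \sum_(x <- si) \sum_(x' <- si)
        th x * th x' * (a x * y (u x, x) (set_arg psi i (f x'))) =
      \sum_(t <- [seq (u x, x) | x <- si]) (th t.2 * a t.2) *
        y t (set_arg psi i (\sum_(x' <- si) th x' *: f x')).
    rewrite big_map big_seq [RHS]big_seq; apply: eq_bigr => x.
    rewrite mem_filter => /andP[/eqP kxi _] /=.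
    have := yA (u x, x) i; rewrite -{1}kxi kA => yi.
    rewrite (slot_linear_sum usi thE fu fd yi psiu) mulr_sumr.
    by apply: eq_bigr => x' _; ring.
  apply: yC; last by apply: unit_set_arg => //; exact: unit_signed_sum.
    by rewrite map_inj_uniq// => ? ? [].
  (* The factor [v (u x)] is at most 1, so a weight on the pairs [(u x, x)] is bounded by a weight
     on [L]. *)
  move=> w [v [w' [Vv Ww' ww]]]; apply: le_trans (sB _ Ww').
  rewrite big_map big_filter big_mkcond; apply: ler_sum => x _ /=.
  have /andP[v0 v1] := V1 _ Vv (u x); have /andP[w0 _] := W1 _ Ww' x.
  case: ifP => _; last by rewrite mulr_ge0.
  have th1 : `|th x| = 1 by case: (thE x) => ->; rewrite ?normrN normr1.
  by rewrite ww/= normrM th1 mul1r ler_wpM2l// ler_piMl.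
- move=> x; case: (GP (x, M x)) => _ _ _ [psi psiu le]; exists psi => //.
- move=> x; have := Am (u x, x); rewrite (cardsD1 (k x)) kA add1n ltnS//.
- move=> x i; rewrite in_setD1; have := yA (u x, x) i.
  have [->|ik] := eqVneq i (k x); first by move=> _ psi p; rewrite /y' set_arg_set.
  case: ifP => _ /= h.
    move=> psi a p q psiu pu qu apqu; rewrite /y' !(set_argC _ _ _ ik).
    by apply: h => //; exact: unit_set_arg.
  by move=> psi p; rewrite /y' (set_argC _ _ _ ik) h.
Qed.


(** * Iterating the trade until no functional slot is left *)

Fixpoint labels (U : countType) (n : nat) : countType :=
  if n is n'.+1 then (U * labels U n')%type : countType else unit.

Fixpoint weights (U : countType) (V : set (U -> K)) (n : nat) : set (labels U n -> K) :=
  if n is n'.+1 then prod_weights V (@weights U V n') else [set w | w = fun=> 1].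
#[global] Arguments weights {U} V n.

Lemma subunit_weights (U : countType) (V : set (U -> K)) n :
  subunit V -> subunit (weights V n).
Proof.
move=> V1; elim: n => [|n IH] /= w; first by move=> -> x; rewrite ler01 lexx.
move=> [v [w' [Vv Ww' ww]]] x; rewrite ww.
have /andP[v0 v1] := V1 _ Vv x.1; have /andP[w0 w1] := IH _ Ww' x.2.
by rewrite mulr_ge0//= mulr_ile1.
Qed.

(** Each trade lowers [m] and [n] together. At [m = 0] the sets of slots are empty, whereas
    [exists_tail_slot] would produce an element of one. *)
Theorem no_separated_family (U : countType) (V : set (U -> K)) m n :
  small_averages V -> subunit V -> (m < n)%N -> ~ separated_family (weights V n) m.
Proof.
move=> Vs V1; elim: m n => [|m IH] [//|n] mn.
  move=> /= [y A C c C0 c0 yC yc Am yA].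
  have [x _] : exists x : labels U n, True.
    have [[|u s] [_ + _]] := Vs 1 ltr01; first by [].
    move=> _; elim: (n) => [|n' [x _]]; first by exists tt.
    by exists (u, x).
  have [d [dA _ _ _]] :=
    exists_tail_slot x 0 Vs V1 (subunit_weights V1) yC C0 yc c0 yA.
  by have := Am (d.1.1, x); rewrite leqn0 cards_eq0 => /eqP A0; rewrite A0 inE in dA.
move=> /(separated_family_step Vs V1 (subunit_weights V1)); exact: IH.
Qed.

End families.

(** * Rademacher vectors *)

(** This identity yields the orthogonality of Rademacher sequences for real and complex scalars
    alike, without conjugation. *)
Definition parallelogram (K : numFieldType) :=
  forall a b : K, `|a + b| ^+ 2 + `|a - b| ^+ 2 = 2 * (`|a| ^+ 2 + `|b| ^+ 2).

Section rademacher.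
Variable K : numFieldType.

(** The parity of the quotient is the [s]-th binary digit of [l]. *)
Definition rademacher (s l : nat) : K := (-1) ^+ (l %/ 2 ^ s)%N.

Lemma norm_rademacher s l : `|rademacher s l| = 1.
Proof. by rewrite normrX normrN1 expr1n. Qed.

(** Pair [l < 2 ^ k] with [l + 2 ^ k]: the digits below [k] agree and digit [k] differs, so the
    parallelogram identity splits off [sg k]. *)
Lemma rademacher_sum_sqr (sg : nat -> K) k : parallelogram K ->
  \sum_(0 <= l < 2 ^ k) `|\sum_(0 <= s < k) sg s * rademacher s l| ^+ 2 =
    2 ^+ k * \sum_(0 <= s < k) `|sg s| ^+ 2.
Proof.
move=> par; elim: k => [|k IH].
  by rewrite expn0 big_nat1 !big_geq// normr0 mulr0 expr0n.
have split_sum (F : nat -> K) : \sum_(0 <= l < 2 ^ k.+1) F l =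
    \sum_(0 <= l < 2 ^ k) (F l + F (l + 2 ^ k)%N).
  rewrite big_split/= (@big_cat_nat _ _ _ (2 ^ k)%N)//=; last first.
    by rewrite leq_exp2l.
  congr (_ + _); rewrite -{1}(add0n (2 ^ k)%N) big_addn expnS mul2n -addnn addnK.
  by [].
rewrite split_sum.
pose z l := \sum_(0 <= s < k) sg s * rademacher s l.
rewrite (eq_big_nat _ _ (F2 := fun l => 2 * (`|z l| ^+ 2 + `|sg k| ^+ 2))); last first.
  move=> l /andP[_ lk]; rewrite -par !big_nat_recr//=.
  have -> : rademacher k l = 1 by rewrite /rademacher divn_small.
  have -> : rademacher k (l + 2 ^ k) = -1.
    by rewrite /rademacher divnDr// divnn expn_gt0 divn_small.
  rewrite mulr1 mulrN1; congr (_ + `|_ - _| ^+ 2).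
  apply: eq_big_nat => s /andP[_ sk]; congr (_ * _).
  (* The quotient grows by [2 ^ (k - s)], which is even as [s < k]. *)
  rewrite /rademacher divnDr ?dvdn_exp2l ?(ltnW sk)//.
  rewrite exprD -expnB ?(ltnW sk)// -[(k - s)%N]prednK ?subn_gt0//.
  by rewrite expnS exprM sqrrN !expr1n mulr1.
rewrite -mulr_sumr big_split/= IH sumr_const_nat subn0 big_nat_recr//= [2 ^+ k.+1]exprS.
rewrite -[_ *+ (2 ^ k)]mulr_natr natrX; ring.
Qed.

(** Cauchy-Schwarz, through [2 t z <= z ^ 2 + t ^ 2]; taking [t * t] sequences avoids square
    roots. *)
Lemma rademacher_sum_le (sg : nat -> K) (t : nat) : parallelogram K -> (0 < t)%N ->
  (forall s, `|sg s| <= 1) ->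
  \sum_(0 <= l < 2 ^ (t * t)) `|\sum_(0 <= s < t * t) sg s * rademacher s l|
    <= 2 ^+ (t * t) * t%:R.
Proof.
move=> par t0 sg1; have t0K : 0 < t%:R :> K by rewrite ltr0n.
have t2 : 0 < 2 * t%:R :> K by rewrite mulr_gt0.
have amgm (z : K) : 0 <= z -> 2 * t%:R * z <= z ^+ 2 + t%:R ^+ 2.
  move=> z0; rewrite -subr_ge0.
  have -> : z ^+ 2 + t%:R ^+ 2 - 2 * t%:R * z = (z - t%:R) ^+ 2 by ring.
  by rewrite real_exprn_even_ge0// realB ?ger0_real.
rewrite -(ler_pM2l t2) mulr_sumr.
apply: le_trans (_ : \sum_(0 <= l < 2 ^ (t * t))
   (`|\sum_(0 <= s < t * t) sg s * rademacher s l| ^+ 2 + t%:R ^+ 2) <= _).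
  by apply: ler_sum => l _; exact: amgm.
rewrite big_split/= rademacher_sum_sqr// sumr_const_nat subn0.
have -> : 2 * t%:R * (2 ^+ (t * t) * t%:R) =
   2 ^+ (t * t) * (t * t)%:R + t%:R ^+ 2 *+ 2 ^ (t * t) :> K.
  rewrite -[_ *+ (2 ^ _)]mulr_natr natrX natrM; ring.
rewrite lerD2r ler_pM2l ?exprn_gt0//.
apply: le_trans (_ : \sum_(0 <= s < t * t) 1 <= _); last by rewrite sumr_const_nat subn0.
by apply: ler_sum => s _; rewrite exprn_ile1.
Qed.

End rademacher.

(** If the naturals had a least upper bound [s], then [s - 1] would be an upper bound too. *)
Lemma scalar_unbounded (K : scalarFieldType) (M : K) : M \is Num.real -> exists n : nat, M <= n%:R.
Proof.
move=> Mr; apply/not_existsP => h.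
have hM n : n%:R <= M.
  by have /negP := h n; rewrite -real_ltNge ?realn//; exact: ltW.
have [s [sub sleast]] : exists s, supremums (range (fun n : nat => n%:R : K)) s.
  apply: nneg_completeP; first by exists 0, 0%N.
    by move=> _ [n _ <-]; rewrite ler0n.
  by exists M => _ [n _ <-].
have : s <= s - 1.
  apply: sleast => _ [n _ <-]; rewrite lerBrDr natr1.
  by apply: sub; exists n.+1.
by rewrite lerDl oppr_ge0 ler10.
Qed.

(** * Unit vectors and truncations in l_1 *)

Section ell1_vectors.
Variable K : scalarFieldType.
Local Notation X := (ell1 K).

Definition basis_fun (l : nat) : nat -> K^o := fun i => (i == l)%:R.

Lemma l1_partial_basis l n : l1_partial (basis_fun l) n <= 1.
Proof.
rewrite /l1_partial; have [ln|nl] := ltnP l n.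
  rewrite (bigD1 (Ordinal ln))//= /basis_fun eqxx normr1 big1 ?addr0// => i il.
  by rewrite (_ : (i == l :> nat) = false) ?normr0//; apply/negbTE.
rewrite big1// => i _; rewrite /basis_fun (_ : (i == l :> nat) = false) ?normr0//.
by apply: ltn_eqF; exact: leq_trans nl.
Qed.

Lemma basis_fun_l1 l : basis_fun l \in @l1_pred K.
Proof. by apply/asboolP; exists 1; exact: l1_partial_basis. Qed.

Definition l1_basis l : X := exist _ (basis_fun l) (basis_fun_l1 l).

Lemma l1_basis_le1 l : `|l1_basis l| <= 1.
Proof. by apply: l1_norm_le => n; exact: l1_partial_basis. Qed.

Lemma val_l1_sum (T : Type) (s : seq T) (F : T -> X) i :
  val (\sum_(t <- s) F t) i = \sum_(t <- s) val (F t) i.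
Proof. by elim: s => [|t s IH]; rewrite ?big_nil ?big_cons//= -IH. Qed.

Definition l1_head (N : nat) (x : X) : X := \sum_(0 <= l < N) (val x l : K) *: l1_basis l.

Lemma basis_funZ (a : K) l i : (a *: basis_fun l) i = if i == l then a else 0.
Proof.
rewrite (_ : (a *: basis_fun l) i = a * (i == l)%:R)//.
by case: eqP; rewrite ?mulr1 ?mulr0.
Qed.

Lemma val_l1_head N x i : val (l1_head N x) i = if (i < N)%N then val x i else 0.
Proof.
rewrite val_l1_sum; case: ifPn => iN.
  rewrite (bigD1_seq i) ?iota_uniq ?mem_index_iota//= basis_funZ eqxx.
  by rewrite big1 ?addr0// => l li; rewrite basis_funZ eq_sym (negPf li).
rewrite big_seq big1// => l; rewrite mem_index_iota => /andP[_ lN] /=.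
by rewrite basis_funZ; case: eqP iN => // ->; rewrite lN.
Qed.

(** Once a partial sum reaches [|x| - e], the remainder has norm at most [e]. *)
Lemma l1_head_cvg (x : X) (e : K) : 0 < e ->
  exists N0, forall N, (N0 <= N)%N -> `|x - l1_head N x| <= e.
Proof.
move=> e0.
have [N0 hN0] : exists N0, `|x| - e <= l1_partial (val x) N0.
  apply/not_existsP => h.
  have : `|x| <= `|x| - e.
    apply: l1_norm_le => n; have /negP := h n.
    have pr : l1_partial (val x) n \is Num.real by rewrite ger0_real// l1_partial_ge0.
    by rewrite -real_ltNge// ?realB ?normr_real ?gtr0_real//; exact: ltW.
  by rewrite lerDl oppr_ge0 lt_geF.
exists N0 => N N0N; apply: l1_norm_le => n.
have mono i j : (i <= j)%N -> l1_partial (val x) i <= l1_partial (val x) j.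
  elim: j => [|j IH]; first by rewrite leqn0 => /eqP ->.
  rewrite leq_eqVlt => /predU1P[->//|/IH /le_trans]; apply.
  by rewrite /l1_partial big_ord_recr/= lerDl.
have [nN|Nn] := leqP n N.
  rewrite /l1_partial big1 ?ltW// => i _.
  have -> : val (x - l1_head N x) i = val x i - val (l1_head N x) i by [].
  by rewrite val_l1_head (leq_trans _ nN)// subrr normr0.
have split_sum (f : nat -> K) : l1_partial f n = l1_partial f N + \sum_(N <= i < n) `|f i|.
  rewrite /l1_partial -!(big_mkord xpredT (fun i => `|f i|)).
  by rewrite (@big_cat_nat _ _ _ N)//= ltnW.
have headE i : val (x - l1_head N x) i = val x i - val (l1_head N x) i by [].
have -> : l1_partial (val (x - l1_head N x)) n = l1_partial (val x) n - l1_partial (val x) N.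
  rewrite !split_sum addrAC subrr add0r {1}/l1_partial big1 ?add0r.
    apply: eq_big_nat => i /andP[Ni _].
    by rewrite headE val_l1_head ltnNge Ni subr0.
  by move=> i _; rewrite headE val_l1_head ltn_ord subrr normr0.
rewrite lerBlDr -lerBlDl; apply: le_trans (mono _ _ N0N).
by apply: le_trans hN0; rewrite lerD2r l1_partial_le.
Qed.

End ell1_vectors.

(** * Normalised Rademacher vectors and finitely supported functionals *)

Section functionals.
Variable K : scalarFieldType.
Local Notation X := (ell1 K).

Implicit Types (p q : {poly K}) (x : X).

(** For [t = (k, s)], the [s]-th Rademacher sequence on the first [2 ^ k] coordinates, normalised in
    l_1. *)
Definition walsh_vector (t : nat * nat) : X :=
  \sum_(0 <= l < 2 ^ t.1) (rademacher K t.2 l / 2 ^+ t.1) *: l1_basis K l.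

Definition dual_weights : set (nat * nat -> K) :=
  [set v | exists phi : dual_ball X, v = fun t => `|phi (walsh_vector t)|].

Lemma dual_walsh (phi : dual_ball X) t :
  phi (walsh_vector t) =
    (2 ^+ t.1)^-1 * \sum_(0 <= l < 2 ^ t.1) rademacher K t.2 l * phi (l1_basis K l).
Proof.
rewrite linear_sum mulr_sumr; apply: eq_bigr => l _.
by rewrite linearZ/= mulrA [_^-1 * _]mulrC.
Qed.

Lemma dual_basis_le1 (phi : dual_ball X) l : `|phi (l1_basis K l)| <= 1.
Proof. exact: le_trans (dual_le1 _ _) (l1_basis_le1 _ _). Qed.

Lemma subunit_dual_weights : subunit dual_weights.
Proof.
move=> _ [phi ->] t; rewrite normr_ge0 dual_walsh normrM normfV normrX.
have n2 : `|2 : K| = 2 by rewrite ger0_norm.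
rewrite n2 ler_pdivrMl ?exprn_gt0// mulr1; apply: le_trans (ler_norm_sum _ _ _) _.
apply: le_trans (_ : \sum_(0 <= l < 2 ^ t.1) 1 <= _).
  by apply: ler_sum => l _; rewrite normrM norm_rademacher mul1r dual_basis_le1.
by rewrite sumr_const_nat subn0 -natrX.
Qed.

(** Inserting phases and exchanging sums reduces the claim to [rademacher_sum_le], which bounds the
    sum over [t * t] vectors by [t]. *)
Lemma small_averages_dual_weights : parallelogram K -> small_averages dual_weights.
Proof.
move=> par e e0.
(* This choice makes [t] at most [e * t ^ 2]. *)
have [t te] : exists t : nat, e^-1 <= t%:R.
  by apply: scalar_unbounded; rewrite realV gtr0_real.
have t0 : (0 < t)%N.
  by rewrite -(ltr0n K); apply: lt_le_trans te; rewrite invr_gt0.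
exists [seq (t * t, s)%N | s <- index_iota 0 (t * t)]; split.
- by rewrite map_inj_uniq ?iota_uniq// => ? ? [].
- by rewrite -size_eq0 size_map size_iota subn0 muln_eq0 orbb -lt0n t0.
move=> _ [phi ->]; rewrite big_map size_map size_iota subn0.
apply: le_trans (_ : t%:R <= _); last first.
  rewrite natrM mulrA ler_pMl ?ltr0n//.
  by rewrite -ler_pdivrMl// mulr1.
pose z s := phi (walsh_vector (t * t, s)%N).
have -> : \sum_(0 <= s < t * t) `|z s| = \sum_(0 <= s < t * t) phase (z s) * z s.
  by apply: eq_bigr => s _; rewrite phaseM.
rewrite -[leLHS]ger0_norm; last by apply: sumr_ge0 => s _; rewrite phaseM.
have -> : \sum_(0 <= s < t * t) phase (z s) * z s = (2 ^+ (t * t))^-1 *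
    \sum_(0 <= l < 2 ^ (t * t)) phi (l1_basis K l) *
      \sum_(0 <= s < t * t) phase (z s) * rademacher K s l.
  under [in RHS]eq_bigr do rewrite mulr_sumr.
  rewrite exchange_big mulr_sumr; apply: eq_bigr => s _ /=.
  rewrite {2}/z dual_walsh mulrCA !mulr_sumr; apply: eq_bigr => l _; ring.
have n2 : `|2 : K| = 2 by rewrite ger0_norm.
rewrite normrM normfV normrX n2 ler_pdivrMl ?exprn_gt0//.
apply: le_trans (rademacher_sum_le par t0 (fun s => phase_le1 (z s))).
apply: le_trans (ler_norm_sum _ _ _) _; apply: ler_sum => l _.
by rewrite normrM ler_piMl// dual_basis_le1.
Qed.

Definition poly_fun (p : {poly K}) (x : X) : K^o :=
  \sum_(0 <= i < size p) p`_i * val x i.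

Lemma poly_funE p N x : (size p <= N)%N -> poly_fun p x = \sum_(0 <= i < N) p`_i * val x i.
Proof.
move=> pN; rewrite [RHS](@big_cat_nat _ _ _ (size p))//= addrC big_nat big1 ?add0r//.
by move=> i /andP[pi _]; rewrite nth_default ?mul0r.
Qed.

Lemma poly_fun_is_linear p : linear_for *%R (poly_fun p).
Proof.
move=> a x y; rewrite /poly_fun mulr_sumr -big_split/=; apply: eq_bigr => i _.
rewrite (_ : (sval x : nat -> K^o) i = val x i)//.
by rewrite [_ *: _]/GRing.scale/= mulrDr mulrCA.
Qed.

HB.instance Definition _ p := GRing.isLinear.Build K X K^o *%R (poly_fun p) (poly_fun_is_linear p).

Lemma poly_fun_le p : unit_poly p -> forall x, `|poly_fun p x| <= `|x|.
Proof.
move=> pu x; apply: le_trans (ler_norm_sum _ _ _) _.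
apply: le_trans (l1_partial_le x (size p)).
rewrite /l1_partial -(big_mkord xpredT (fun i => `|val x i|)).
by apply: ler_sum => i _; rewrite normrM ler_piMl// pu.
Qed.

(* The value [zero_dual] outside the unit ball is never used. *)
Definition poly_dual (p : {poly K}) : dual_ball X :=
  if pselect (unit_poly p) is left pu then DualBall (poly_fun_le pu) else zero_dual X.

Lemma poly_dualE p : unit_poly p -> poly_dual p =1 poly_fun p.
Proof. by move=> pu x; rewrite /poly_dual; case: pselect. Qed.

Lemma poly_fun_linear a p q x : poly_fun (a *: p + q) x = a * poly_fun p x + poly_fun q x.
Proof.
pose N := maxn (size (a *: p + q)) (maxn (size p) (size q)).
rewrite !(@poly_funE _ N) ?leq_max ?leqnn ?orbT//.
rewrite mulr_sumr -big_split/=; apply: eq_bigr => i _.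
by rewrite coefD coefZ mulrDl mulrA.
Qed.

Definition dual_poly (phi : dual_ball X) N : {poly K} := \poly_(i < N) phi (l1_basis K i).

Lemma unit_dual_poly phi N : unit_poly (dual_poly phi N).
Proof.
by move=> i; rewrite coef_poly; case: ifP; rewrite ?normr0 ?dual_basis_le1.
Qed.

Lemma poly_dual_head phi N x : poly_dual (dual_poly phi N) x = phi (l1_head N x).
Proof.
rewrite poly_dualE; last exact: unit_dual_poly.
rewrite (poly_funE _ (size_poly _ _)) linear_sum; apply: eq_big_nat => i /andP[_ iN].
by rewrite coef_poly iN linearZ/= mulrC.
Qed.

(** Convergence is only pointwise in [x], which is enough for finite sums of elementary tensors. *)
Lemma poly_dual_cvg phi x : (fun N => poly_dual (dual_poly phi N) x : K^o) @ \oo --> (phi x : K^o).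
Proof.
apply/cvgrPdist_le => e e0; have [N0 hN0] := l1_head_cvg x e0.
exists N0 => // N N0N /=; rewrite poly_dual_head.
by rewrite -raddfB; apply: le_trans (dual_le1 _ _) (hN0 _ N0N).
Qed.

End functionals.

Arguments dual_weights : clear implicits.

(** * Tensors as forms *)

Section tensor_forms.
Variable K : scalarFieldType.
Local Notation X := (ell1 K).
Implicit Types (p q : {poly K}).

Lemma elem_tensor_inj n (x : 'I_n -> X) : elem_tensor x \in @inj_pred K X n.
Proof.
apply/asboolP => e e0; exists [:: (1, x)] => phi.
by rewrite /tensor_comb big_seq1 scale1r subrr normr0 ltW.
Qed.

Definition elem n (x : 'I_n -> X) : inj_tensor_power X n := 
  exist (fun u => u \in @inj_pred K X n) (elem_tensor x) (elem_tensor_inj x).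

Lemma val_inj_sum n (T : Type) (s : seq T) (F : T -> inj_tensor_power X n) phi :
  val (\sum_(t <- s) F t) phi = \sum_(t <- s) val (F t) phi.
Proof. by elim: s => [|t s IH]; rewrite ?big_nil ?big_cons//= -IH. Qed.

Definition tensor_form m (v : inj_tensor_power X m) (psi : 'I_m -> {poly K}) : K :=
  val v (fun i => poly_dual (psi i)).

Lemma tensor_comb_linear m s k (psi : 'I_m -> {poly K}) a p q :
  unit_poly p -> unit_poly q -> unit_poly (a *: p + q) ->
  tensor_comb s (fun i => poly_dual (set_arg psi k (a *: p + q) i)) =
  a * tensor_comb s (fun i => poly_dual (set_arg psi k p i)) +
    tensor_comb s (fun i => poly_dual (set_arg psi k q i)).
Proof.
move=> pu qu apqu; rewrite /tensor_comb mulr_sumr -big_split/=.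
apply: eq_bigr => -[b x] _ /=.
pose P := \prod_(i < m | i != k) poly_dual (psi i) (x i).
have PE r : unit_poly r ->
    elem_tensor x (fun i => poly_dual (set_arg psi k r i)) = poly_fun r (x k) * P.
  move=> ru; rewrite /elem_tensor (bigD1 k)//= /set_arg eqxx poly_dualE//; congr (_ * _).
  by apply: eq_bigr => i /negPf ->.
rewrite !PE// poly_fun_linear /GRing.scale/=; ring.
Qed.

(** The identity is exact for finite sums of elementary tensors and passes to uniform limits; three
    errors enter, with coefficients 1, [|a|] and 1. *)
Lemma tensor_form_slot_linear m (v : inj_tensor_power X m) k : slot_linear (tensor_form v) k.
Proof.
move=> psi a p q _ pu qu apqu.
have a20 : 0 < `|a| + 2 by rewrite ltr_wpDl.
apply/eqP; rewrite -subr_eq0 -normr_le0; apply/ler_addgt0Pr => e e0; rewrite add0r.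
have d0 : 0 < e / (`|a| + 2) by rewrite divr_gt0.
have /asboolP/(_ _ d0)[s hs] := valP v.
pose tc p' := tensor_comb s (fun i => poly_dual (set_arg psi k p' i)).
pose D p' := tensor_form v (set_arg psi k p') - tc p'.
have Dle p' : `|D p'| <= e / (`|a| + 2) by exact: hs.
have -> : tensor_form v (set_arg psi k (a *: p + q)) -
    (a * tensor_form v (set_arg psi k p) + tensor_form v (set_arg psi k q)) =
    D (a *: p + q) - a * D p - D q.
  have tcE : tc (a *: p + q) = a * tc p + tc q by exact: tensor_comb_linear.
  by rewrite /D tcE; ring.
apply: le_trans (_ : e / (`|a| + 2) + `|a| * (e / (`|a| + 2)) + e / (`|a| + 2) <= _).
  apply: le_trans (ler_normB _ _) _; apply: lerD => //.
  apply: le_trans (ler_normB _ _) _; apply: lerD => //.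
  by rewrite normrM ler_wpM2l.
have -> : e / (`|a| + 2) + `|a| * (e / (`|a| + 2)) + e / (`|a| + 2) =
  (`|a| + 2) * (e / (`|a| + 2)) by ring.
by rewrite mulrC divfK// gt_eqF.
Qed.

(** Approximate [v] uniformly by a finite sum of elementary tensors, on which truncating the
    functionals converges. *)
Lemma tensor_form_dense m (v : inj_tensor_power X m) phi e : 0 < e ->
  exists N, `|val v phi - tensor_form v (fun i => dual_poly (phi i) N)| <= e.
Proof.
move=> e0; have d0 : 0 < e / 3 by rewrite divr_gt0.
have /asboolP/(_ _ d0)[s hs] := valP v.
pose phiN N : 'I_m -> dual_ball X := fun i => poly_dual (dual_poly (phi i) N).
have cv : (fun N => tensor_comb s (phiN N) : K^o) @ \oo --> (tensor_comb s phi : K^o).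
  apply: cvg_big => [|t _]; first exact: add_continuous.
  apply: cvgZr.
  apply: cvg_big => [|i _]; first exact: mul_continuous.
  exact: poly_dual_cvg.
move/cvgrPdist_le: cv => /(_ _ d0) [N _ /(_ N (leqnn N))] /= hN.
exists N; rewrite /tensor_form -/(phiN N).
have -> : val v phi - val v (phiN N) = (val v phi - tensor_comb s phi) +
   (tensor_comb s phi - tensor_comb s (phiN N)) - (val v (phiN N) - tensor_comb s (phiN N)).
  by ring.
have -> : e = e / 3 + e / 3 + e / 3 by field.
apply: le_trans (ler_normB _ _) _; apply: lerD; last exact: hs.
by apply: le_trans (ler_normD _ _) _; apply: lerD => //; exact: hs.
Qed.

(** Some [phi] reaches two thirds of [d]; truncating its functionals loses at most one third. *)
Lemma exists_unit_form m (v : inj_tensor_power X m) (d : K) : 0 < d -> d <= `|v| ->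
  exists2 psi, unit_args psi & d / 3 <= `|tensor_form v psi|.
Proof.
move=> d0 dv; have d30 : 0 < d / 3 by rewrite divr_gt0.
have [phi hphi] : exists phi, d / 3 + d / 3 <= `|val v phi|.
  apply/not_existsP => h.
  have : `|v| <= d / 3 + d / 3.
    apply: inj_norm_le => phi; have /negP := h phi.
    by rewrite -real_ltNge ?normr_real ?gtr0_real ?addr_gt0//; exact: ltW.
  move=> /(le_trans dv); apply/negP; rewrite lt_geF//.
  have {3}-> : d = d / 3 + d / 3 + d / 3 by field.
  by rewrite ltrDl.
have [N hN] := tensor_form_dense v phi d30.
exists (fun i => dual_poly (phi i) N); first by move=> i; exact: unit_dual_poly.
rewrite -(lerD2r (d / 3)); apply: le_trans hphi _.
set w := tensor_form _ _ in hN *.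
rewrite -[val v phi](subrK w); apply: le_trans (ler_normD _ _) _.
by rewrite addrC lerD2l.
Qed.

Fixpoint label_vectors n : labels (nat * nat)%type n -> 'I_n -> X :=
  if n is n'.+1 then fun x i =>
    if unlift ord0 i is Some j then @label_vectors n' x.2 j else walsh_vector K x.1
  else fun _ _ => 0.

(** Every [phi] in the supremum defining the injective norm yields a weight, so bounds over all
    weights bound injective norms. *)
Lemma weight_elem_tensor n (phi : 'I_n -> dual_ball X) :
  weights (dual_weights K) n (fun x => `|elem_tensor (@label_vectors n x) phi|).
Proof.
elim: n phi => [|n IH] phi /=.
  by apply/funext => x; rewrite /elem_tensor big_ord0 normr1.
exists (fun t => `|phi ord0 (walsh_vector K t)|).
exists (fun x => `|elem_tensor (label_vectors x) (fun i => phi (lift ord0 i))|).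
split; [by exists (phi ord0)|exact: IH|].
move=> x; rewrite -normrM /elem_tensor big_ord_recl unlift_none.
by congr `|_ * _|; apply: eq_bigr => i _; rewrite liftK.
Qed.

(** The sign pattern of [walsh_vector t], hence a norming functional for it. *)
Definition walsh_poly (t : nat * nat) : {poly K} := \poly_(l < 2 ^ t.1) rademacher K t.2 l.

Lemma unit_walsh_poly t : unit_poly (walsh_poly t).
Proof. by move=> i; rewrite coef_poly; case: ifP; rewrite ?normr0 ?norm_rademacher. Qed.

Lemma poly_dual_basis p l : unit_poly p -> poly_dual p (l1_basis K l) = p`_l.
Proof.
move=> pu; rewrite poly_dualE// (poly_funE _ (leq_maxl (size p) l.+1)).
rewrite (bigD1_seq l) ?iota_uniq ?mem_index_iota ?leq_maxr//= /basis_fun eqxx mulr1.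
by rewrite big1 ?addr0// => i /negPf il; rewrite il mulr0.
Qed.

Lemma walsh_poly_vector t : poly_dual (walsh_poly t) (walsh_vector K t) = 1.
Proof.
rewrite dual_walsh.
have -> : \sum_(0 <= l < 2 ^ t.1) rademacher K t.2 l *
    poly_dual (walsh_poly t) (l1_basis K l) = 2 ^+ t.1.
  rewrite -natrX -[in RHS](subn0 (2 ^ t.1)%N) -sumr_const_nat; apply: eq_big_nat => l /andP[_ lt].
  rewrite poly_dual_basis; last exact: unit_walsh_poly.
  by rewrite coef_poly lt -expr2 sqrr_sign.
by rewrite mulVf ?expf_neq0 ?pnatr_eq0.
Qed.

Lemma elem_norm_ge1 n (x : labels (nat * nat)%type n) : 1 <= `|elem (label_vectors x)|.
Proof.
have [phi hphi] : exists phi, elem_tensor (label_vectors x) phi = 1.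
  elim: n x => [|n IH] x; first by exists (fun=> zero_dual X); rewrite /elem_tensor big_ord0.
  have [phi hphi] := IH x.2.
  exists (fun i => if unlift ord0 i is Some j then phi j else poly_dual (walsh_poly x.1)).
  rewrite /elem_tensor big_ord_recl /= unlift_none walsh_poly_vector mul1r; apply: etrans hphi.
  by apply: eq_bigr => i _; rewrite liftK.
by rewrite -(normr1 K) -hphi; exact: inj_norm_ub (elem _) phi.
Qed.

(** The images of elementary tensors form a separated family with all [m] slots untraded: the upper
    bound on [T] gives domination, the lower bound gives [d / 3]. *)
Theorem no_linear_embedding m n (T : {linear inj_tensor_power X n -> inj_tensor_power X m})
    (C d : K) : parallelogram K -> (m < n)%N -> 0 <= C -> 0 < d ->
  (forall z, `|T z| <= C * `|z|) -> (forall z, 1 <= `|z| -> d <= `|T z|) -> False.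
Proof.
move=> par mn C0 d0 TC Td.
apply: (@no_separated_family K 'I_m _ (dual_weights K) m n) => //.
- exact: small_averages_dual_weights.
- exact: subunit_dual_weights.
apply: (@SeparatedFamily _ _ _ _ _ (fun x => tensor_form (T (elem (label_vectors x))))
  (fun=> [set: 'I_m]%SET) C (d / 3)) => //.
- by rewrite divr_gt0.
- move=> s a B psi us hB psiu.
  pose z := \sum_(x <- s) a x *: elem (label_vectors x).
  have -> : \sum_(x <- s) a x * tensor_form (T (elem (label_vectors x))) psi =
      val (T z) (fun i => poly_dual (psi i)).
    rewrite linear_sum val_inj_sum; apply: eq_bigr => x _.
    by rewrite linearZ.
  apply: le_trans (inj_norm_ub _ _) _; apply: le_trans (TC _) _; rewrite ler_wpM2l//.
  apply: inj_norm_le => phi; rewrite val_inj_sum.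
  apply: le_trans (hB _ (weight_elem_tensor phi)); apply: le_trans (ler_norm_sum _ _ _) _.
  by apply: ler_sum => x _; rewrite -normrM.
- by move=> x; apply: exists_unit_form => //; apply: Td; exact: elem_norm_ge1.
- by move=> x; rewrite cardsT card_ord.
- by move=> x k; rewrite inE; exact: tensor_form_slot_linear.
Qed.

End tensor_forms.

(** * From an isomorphism to norm bounds, and the conclusion *)

Lemma isomorphic_to_subspace_bounds (K : numFieldType) (E F : normedModType K) :
  isomorphic_to_subspace E F -> exists (T : {linear E -> F}) (C d : K),
    [/\ 0 <= C, 0 < d, forall z, `|T z| <= C * `|z| & forall z, 1 <= `|z| -> d <= `|T z|].
Proof.
move=> [Y [_ [f [g [fc fY fg gc]]]]].
have [C C0 fC] : exists2 C, 0 < C & forall z, `|f z| <= C * `|z|.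
  by apply: pinfty_ex_gt => //; apply/linear_boundedP/linear_bounded_continuous.
have Y0 : Y 0 by rewrite -fY; exists 0 => //; exact: linear0.
have g0 : g 0 = 0 by rewrite -(linear0 f) fg.
(* Continuity of [g] at 0 within [Y] gives [d] such that [|f z| < d] forces [|z| < 1]; the lower
   bound is the contrapositive. *)
have : \forall y \near (0 : subspace Y), `|g y| < 1.
  have /cvgrPdist_lt/(_ 1 ltr01) := gc 0; apply: filterS => y /=.
  by rewrite /from_subspace g0 sub0r normrN.
move=> /(nbhs_subspace_ex _ Y0)[V /nbhs_normP[d /= d0 dV] VE].
exists f, C, d; split=> //; first exact: ltW.
move=> z z1; rewrite real_leNgt ?normr_real ?gtr0_real//; apply/negP => fzd.
have : ([set y | `|g y| < 1] `&` Y) (f z).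
  rewrite VE; split; last by rewrite -fY; exists z.
  by apply: dV; rewrite /= sub0r normrN.
by move=> [/=]; rewrite fg => /(le_lt_trans z1); rewrite ltxx.
Qed.

Lemma parallelogram_real (R : realType) : parallelogram R.
Proof. by move=> a b; rewrite !real_normK ?num_real//; ring. Qed.

Lemma parallelogram_complex (R : realType) : parallelogram R[i].
Proof. by move=> a b; rewrite !normCK rmorphD rmorphB; ring. Qed.

Theorem corollary1p2 (R : realType) (m n : nat) :
  (0 < m)%N -> (m < n)%N ->
  ~ isomorphic_to_subspace (inj_tensor_power (ell1 R) n)
                           (inj_tensor_power (ell1 R) m) /\
  ~ isomorphic_to_subspace (inj_tensor_power (ell1 R[i]) n)
                           (inj_tensor_power (ell1 R[i]) m).
Proof.
move=> _ mn; split => /isomorphic_to_subspace_bounds[T [C [d [C0 d0 TC Td]]]].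
  exact: (no_linear_embedding (@parallelogram_real R) mn C0 d0 TC Td).
exact: (no_linear_embedding (@parallelogram_complex R) mn C0 d0 TC Td).
Qed.
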